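(* If $\mathcal A$ is an automaton belonging to the family $\mathfrak F$, then the states of $\mathcal A$ freely generate a free group; that is, $\mathbb G(\mathcal A)$ is a free group, freely generated by the transformations $\mathcal A_q$, where $q$ runs over the states of $\mathcal A$. In particular, for every even number $n\geq 4$, there is an $n$-state connected automaton over a binary alphabet whose states freely generate a free group of rank $n$.
   Context: A finite (Mealy) automaton is a $4$-tuple $\mathcal A=(Q,A,\delta,\lambda)$ with $Q$ a finite set of states, $A$ a finite alphabet, $\delta:Q\times A\to Q$ and $\lambda:Q\times A\to A$; write $q_x=\delta(q,x)$ and $q(x)=\lambda(q,x)$. Each state $q$ defines a length-preserving map $\mathcal A_q:A^*\to A^*$, $w\mapsto q(w)$, fixing the empty word and satisfying $q(xu)=q(x)\,q_x(u)$ for $x\in A$, $u\in A^*$. The automaton is invertible if for each $q\in Q$ the map $x\mapsto q(x)$ is a permutation of $A$; then each $\mathcal A_q$ is a bijection and $\mathbb G(\mathcal A)$ denotes the group of bijections of $A^*$ generated by the $\mathcal A_q$, $q\in Q$. An automaton is connected if its transition diagram (vertex set $Q$, edges $q\to q_x$) is connected. Over the alphabet $\{0,1\}$, write $q=\sigma(r,s)$ to mean $q(x)=\sigma(x)$ for $x\in\{0,1\}$, $q_0=r$, $q_1=s$; here $\sigma$ is a permutation of $\{0,1\}$, $(01)$ denotes the transposition. The family $\mathfrak F$ consists of all automata over $\{0,1\}$ of the following form: for some odd integer $n\ge 1$, the state set is $Q_n=\{a,b,c,d_1,\dots,d_n\}$ ($n+3$ states), and $$a=(01)(c,b),\quad b=(01)(b,c),\quad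 c=\sigma_0(d_1,d_1),\quad d_i=\sigma_i(d_{i+1},d_{i+1})\ (1\le i\le n-1),\quad d_n=\sigma_n(a,a),$$ where $\sigma_0,\dots,\sigma_n$ are permutations of $\{0,1\}$ an odd number of which are not the identity. *)

(* Defs.v *)
From HB Require Import structures.
From mathcomp Require Import all_boot all_fingroup.
From mathcomp Require Import boolp classical_sets.

Set Implicit Arguments.
Unset Strict Implicit.
Unset Printing Implicit Defensive.

Local Open Scope classical_set_scope.

(** * The group of all bijections of a type *)

(* The inverse is stored as data; it is determined by the map (lemma [symP]). *)
Record sym (T : Type) := MkSym {
  sym_fun :> T -> T;
  sym_inv : T -> T;
  sym_funK : cancel sym_fun sym_inv;
  sym_invK : cancel sym_inv sym_fun
}.

Lemma symP (T : Type) (f g : sym T) : f =1 g -> f = g.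
Proof.
case: f => f f' fK f'K; case: g => g g' gK g'K /= /funext fg.
case: g / fg in gK g'K *.
have e : f' = g' by apply: funext => x; rewrite -[in LHS](g'K x) fK.
case: g' / e in gK g'K *.
by rewrite (Prop_irrelevance fK gK) (Prop_irrelevance f'K g'K).
Qed.

HB.instance Definition _ (T : Type) := gen_eqMixin (sym T).
HB.instance Definition _ (T : Type) := gen_choiceMixin (sym T).

Section SymGroup.
Variable T : Type.
Implicit Types f g h : sym T.

Definition sym_one : sym T := @MkSym T id id (fun=> erefl) (fun=> erefl).

Definition sym_opp f : sym T := MkSym (@sym_invK T f) (@sym_funK T f).

(* (f * g) x = f (g x) *)
Definition sym_mul f g : sym T :=
  MkSym (can_comp (@sym_funK T f) (@sym_funK T g))
      (can_comp (@sym_invK T g) (@sym_invK T f)).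

Lemma sym_mulA : associative sym_mul.
Proof. by move=> f g h; apply: symP. Qed.

Lemma sym_mul1 : left_id sym_one sym_mul.
Proof. by move=> f; apply: symP. Qed.

Lemma sym_mulr1 : right_id sym_one sym_mul.
Proof. by move=> f; apply: symP. Qed.

Lemma sym_mulV : left_inverse sym_one sym_opp sym_mul.
Proof. by move=> f; apply: symP => x /=; rewrite sym_funK. Qed.

Lemma sym_mulrV : right_inverse sym_one sym_opp sym_mul.
Proof. by move=> f; apply: symP => x /=; rewrite sym_invK. Qed.

HB.instance Definition _ := isGroup.Build (sym T)
  sym_mulA sym_mul1 sym_mulr1 sym_mulV sym_mulrV.

End SymGroup.

(** * Free groups *)

Definition is_subgroup (G : groupType) (H : set G) : Prop :=
  H 1%g /\ forall x y, H x -> H y -> H (x * y^-1)%g.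

Definition generated_subgroup (G : groupType) (S : set G) : set G :=
  smallest (@is_subgroup G) S.

(* A group word over the symbols I is a sequence of letters; (i, false) stands
   for the symbol i and (i, true) for its formal inverse. *)
Definition reduced (I : eqType) (w : seq (I * bool)) : bool :=
  sorted (fun k l => ~~ ((k.1 == l.1) && (k.2 != l.2))) w.

Definition word_value (G : groupType) (I : Type) (s : I -> G)
    (w : seq (I * bool)) : G :=
  (\prod_(l <- w) (if l.2 then (s l.1)^-1 else s l.1))%g.

(* The subgroup H is a free group with free basis the family s: mapping reduced
   words to their values is a bijection onto H, so s is in particular
   injective. *)
Definition freely_generated_by (G : groupType) (H : set G) (I : eqType)
    (s : I -> G) : Prop :=
  [/\ is_subgroup H,
      forall i, H (s i)
    & forall x, H x -> exists! w, reduced w /\ word_value s w = x].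

Definition free_of_rank (G : groupType) (H : set G) (n : nat) : Prop :=
  exists s : 'I_n -> G, freely_generated_by H s.

(** * Mealy automata *)

Record mealy (Q A : finType) := Mealy {
  next : Q -> A -> Q;
  out : Q -> A -> A
}.

Section Mealy.
Variables (Q A : finType) (M : mealy Q A).

Fixpoint action (q : Q) (w : seq A) : seq A :=
  if w is x :: u then out M q x :: action (next M q x) u else [::].

Definition invertible : Prop := forall q, bijective (out M q).

Definition edge : rel Q := [rel q r | [exists x, r == next M q x]].

(* Orientation of the edges is ignored. *)
Definition connected : Prop :=
  forall q r, connect (fun u v => edge u v || edge v u) q r.

Section Group.
Hypothesis invM : invertible.

Fixpoint action_inv (q : Q) (w : seq A) : seq A :=
  if w is y :: u then
    let x := invF (bij_inj (invM q)) y in x :: action_inv (next M q x) u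
  else [::].

Lemma actionK q : cancel (action q) (action_inv q).
Proof. by move=> w; elim: w q => //= x u IHu q; rewrite invF_f IHu. Qed.

Lemma action_invK q : cancel (action_inv q) (action q).
Proof. by move=> w; elim: w q => //= y u IHu q; rewrite f_invF IHu. Qed.

Definition transformation (q : Q) : sym (seq A) :=
  MkSym (@actionK q) (@action_invK q).

Definition automaton_group : set (sym (seq A)) :=
  generated_subgroup (range transformation).

End Group.

End Mealy.

(** * The family of automata *)

(* The state d_k, for 1 <= k <= n, is [Sd i] with i : 'I_n of value k - 1. *)
Inductive fstate (n : nat) := Sa | Sb | Sc | Sd of 'I_n.
Arguments Sa {n}.
Arguments Sb {n}.
Arguments Sc {n}.

Definition fstate_code n (q : fstate n) : 'I_3 + 'I_n :=
  match q with
  | Sa => inl (inord 0)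
  | Sb => inl (inord 1)
  | Sc => inl (inord 2)
  | Sd i => inr i
  end.

Definition fstate_decode n (u : 'I_3 + 'I_n) : fstate n :=
  match u with
  | inl k => if k == 0 :> nat then Sa else if k == 1 :> nat then Sb else Sc
  | inr i => Sd i
  end.

Lemma fstate_codeK n : cancel (@fstate_code n) (@fstate_decode n).
Proof. by case=> //=; rewrite !inordK. Qed.

HB.instance Definition _ n := Finite.copy (fstate n)
  (can_type (@fstate_codeK n)).

(* q = s(r0, r1); the letters 0 and 1 are false and true. *)
Definition wreath (Q : finType) (M : mealy Q bool) (q : Q)
    (s : {perm bool}) (r0 r1 : Q) : Prop :=
  [/\ out M q =1 s, next M q false = r0 & next M q true = r1].

(* The permutation sigma_k is sigma k, so the one attached to the state [Sd i]
   is sigma (lift ord0 i), as lift ord0 i has value i + 1. *)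
Definition in_family (n : nat) (M : mealy (fstate n) bool) : Prop :=
  odd n /\
  exists sigma : 'I_n.+1 -> {perm bool},
    odd #|[pred k | sigma k != 1%g]| /\
    [/\ wreath M Sa (tperm false true) Sc Sb,
        wreath M Sb (tperm false true) Sb Sc,
        forall i : 'I_n, i = 0 :> nat ->
          wreath M Sc (sigma ord0) (Sd i) (Sd i),
        forall i j : 'I_n, j = i.+1 :> nat ->
          wreath M (Sd i) (sigma (lift ord0 i)) (Sd j) (Sd j)
      & forall i : 'I_n, i.+1 = n ->
          wreath M (Sd i) (sigma (lift ord0 i)) Sa Sa].

(* Main.v *)
Require Import Defs.
From mathcomp Require Import all_boot all_fingroup.
From mathcomp Require Import boolp classical_sets.

(** Let l_k ... l_1 be a reduced group word over the states, acting on binary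
    sequences with l_1 applied first. Feeding a bit x to it changes x into
    x + parity, where the parity counts the letters that flip bits, and turns
    the word into another word, called [dual x] below; [dual] preserves
    reducedness and the pattern of signs. If a word acts trivially, then so do
    all words in its orbit under the two maps [dual false] and [dual true], and
    they all have even parity. So freeness follows from two facts:

    - all reduced words with a given pattern of signs form one orbit
      ([transitive_on]);
    - on a nonempty pattern the parity is not constantly even.

    In every automaton of the family the next-state maps for the letters 0 and
    1 are pi and pi o (a b), where pi fixes b and is transitive on the other
    states. Only the number of states (even, at least 4) and the set of states
    flipping the bit (of odd size, containing a and b) matter otherwise.

    Transitivity is proved by induction on the length, with a stronger claim:
    the loops at a reduced word w induce on the letters that may be appended to
    w all permutations ([locally_full]). Given w, a loop at w induces a
    permutation alpha of the letters allowed on the left of w and a permutation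
    beta of those allowed on the right. By induction either one is arbitrary,
    and a subgroup of a product of two symmetric groups with full projections
    contains 1 x Sym as soon as it contains a pair of permutations with
    different signs ([subdirect_sym_full], in the spirit of Goursat). Then the
    loops at w fixing a letter p on the left are full on the right, which is
    the claim for p w.

    A pair with different signs exists for the following reason. The signs of
    alpha and beta accumulate along a path, one step [dual x] at u contributing
    to the product of both signs an affine function of the numbers [chi] of the
    letters of u, with all coefficients equal to 1. If the signs agreed on all
    loops, that function would be a coboundary f (dual x u) - f u over F_2. A
    second claim in the same induction ([no_coboundary]) is that an affine
    function of the [chi]'s is a coboundary only if it is zero; it also shows,
    with f = 0, that the parity is not constantly even. To prove it, if the
    last letter does not occur, then local fullness makes f independent of the
    last letter and one applies induction. If it occurs, then summing over the
    last letter, and using that there is an even number of states and an odd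
    number of flipping ones, leaves a forbidden function on shorter words unless
    the last two signs differ and the function is 1 + chi + chi in the last two
    letters. Reading the word backwards moves these two letters to the
    beginning, which is the previous case for words with three letters or more.
    For two letters an explicit cycle of odd length gives a contradiction
    ([pair_not_coboundary]). *)

Set Implicit Arguments.
Unset Strict Implicit.
Unset Printing Implicit Defensive.

Local Open Scope group_scope.

#[local] Arguments reduced : simpl never.

(** * Subgroups of symmetric groups *)

Section PermOn.
Variable T : finType.
Implicit Types (A B : {set T}) (s t : {perm T}) (x y z : T).

Lemma tperm_on_set A x y : x \in A -> y \in A -> perm_on A (tperm x y).
Proof.
move=> Ax Ay; apply: fintype.subset_trans (tperm_on x y) _.
by apply/fintype.subsetP=> z; rewrite !inE => /orP[]/eqP->.
Qed.

Lemma tperm_neqR x u y : x != y -> tperm x u y != u.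
Proof.
apply: contraNneq => e; apply/eqP/(@perm_inj _ (tperm x u)).
by rewrite tpermL e.
Qed.

Lemma perm_on_setT s : perm_on [set: T] s.
Proof. by apply/fintype.subsetP=> x; rewrite !inE. Qed.

Lemma perm_onC1 s z : perm_on [set~ z] s = (s z == z).
Proof.
apply/idP/eqP => [sA|sz]; first by rewrite (out_perm sA) // !inE eqxx.
by apply/fintype.subsetP=> x; rewrite !inE; apply: contraNneq => ->; rewrite sz.
Qed.

(** A permutation is built up from transpositions inside its support: composing
    it with the transposition of x and s x fixes one more point. *)
Lemma perm_on_ind A (P : {perm T} -> Prop) :
  P 1 ->
  (forall x y s, x \in A -> y \in A -> x != y -> perm_on A s -> P s ->
     P (tperm x y * s)) ->
  forall s, perm_on A s -> P s.
Proof.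
move=> P1 Pstep s.
move: {2}(#|[set x | s x != x]|) (leqnn #|[set x | s x != x]|) => n.
elim: n s => [|n IHn] s le_n sA.
  suff -> : s = 1 by [].
  apply/permP=> x; rewrite perm1; apply/eqP; move: le_n.
  rewrite leqn0 cards_eq0 => /eqP/setP/(_ x); rewrite !inE.
  by case: eqP.
have [/existsP[x sx]|] := boolP [exists x, s x != x]; last first.
  rewrite negb_exists => /forallP s1; suff -> : s = 1 by [].
  by apply/permP=> x; rewrite perm1; apply/eqP; rewrite -[_ == _]negbK s1.
have Ax : x \in A by move/fintype.subsetP: sA => /(_ x); apply; rewrite inE.
have Asx : s x \in A by rewrite (perm_closed _ sA).
have tA := perm_onM (tperm_on_set Ax Asx) sA.
rewrite -[s](mulKg (tperm x (s x))) tpermV.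
apply: Pstep; rewrite // 1?eq_sym //; apply: IHn => //.
rewrite -ltnS; apply: leq_trans le_n; apply: proper_card.
apply/fintype.properP; split; last first.
  exists (s x); rewrite !inE ?permM ?tpermR ?eqxx //.
  by rewrite (inj_eq perm_inj).
apply/fintype.subsetP=> y; rewrite !inE permM.
by case: tpermP => [->|->|//]; rewrite ?eqxx // (inj_eq perm_inj) sx.
Qed.

End PermOn.

Section NormalOdd.
Variables (T : finType) (B : {set T}) (K : {perm T} -> Prop).
Hypothesis B_gt2 : 2 < #|B|.
Hypothesis KM : forall s t, K s -> K t -> K (s * t).
Hypothesis KV : forall s, K s -> K s^-1.
Hypothesis KJ : forall s t, K s -> perm_on B t -> K (s ^ t).
Hypothesis KB : forall s, K s -> perm_on B s.

Let C3 x y z := K (tperm x y * tperm x z).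

Let C3J x y z t : C3 x y z -> perm_on B t -> C3 (t x) (t y) (t z).
Proof. by move=> Cxyz tB; have := KJ Cxyz tB; rewrite conjMg !tpermJ. Qed.

(** All 3-cycles on B are conjugate under permutations of B; three successive
    transpositions carry one triple to the other. *)
Lemma three_cycle_moved x y z u v w :
  [/\ x \in B, y \in B & z \in B] -> [/\ x != y, x != z & y != z] ->
  [/\ u \in B, v \in B & w \in B] -> [/\ u != v, u != w & v != w] ->
  C3 x y z -> C3 u v w.
Proof.
case=> Bx By Bz [xy xz yz] [Bu Bv Bw] [uv uw vw] C.
have t1B := tperm_on_set Bx Bu; move/C3J/(_ t1B): C; rewrite tpermL.
have: tperm x u y != u by exact: tperm_neqR.
have: tperm x u z != u by exact: tperm_neqR.
have: tperm x u y != tperm x u z by rewrite (inj_eq perm_inj).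
move: (perm_closed y t1B) (perm_closed z t1B); rewrite By Bz.
move: (tperm x u y) (tperm x u z) => {xy xz yz By Bz t1B}y {}z By Bz yz zu yu C.
have t2B := tperm_on_set By Bv; move/C3J/(_ t2B): C.
rewrite tpermL [tperm y v u]tpermD // 1?eq_sym //.
have: tperm y v z != v by exact: tperm_neqR.
have: tperm y v z != u.
  rewrite -(inj_eq (@perm_inj _ (tperm y v))) tpermK.
  by rewrite (@tpermD _ y v u) // eq_sym.
move: (perm_closed z t2B); rewrite Bz.
move: (tperm y v z) => {yz zu Bz t2B}z Bz zu zv C.
have t3B := tperm_on_set Bz Bw; move/C3J/(_ t3B): C.
by rewrite tpermL !tpermD // 1?eq_sym.
Qed.

(** K is a normal subgroup of the symmetric group of B. The commutator of k with
    a transposition (x z) is (x z)(kx kz), which is a 3-cycle for suitable x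
    and z unless k is an involution without fixed points; being odd, k then has
    at least three 2-cycles, and two such commutators multiply to a 3-cycle.
    Once K contains the 3-cycles, all transpositions agree modulo K, so the
    odd k forces them into K. *)
Lemma odd_normal_full k : K k -> odd_perm k -> forall s, perm_on B s -> K s.
Proof.
move=> Kk odd_k.
have K1 : K 1 by rewrite -(mulgV k); apply: KM => //; apply: KV.
have Bk x : k x != x -> x \in B.
  by move: (KB Kk) => /fintype.subsetP/(_ x) kx kxx; apply: kx; rewrite inE.
have third x y : exists2 z, z \in B & (z != x) && (z != y).
  have /fintype.subsetPn[z Bz] : ~~ (B \subset [set x; y]).
    apply/negP=> /subset_leq_card; rewrite leqNgt cards2; case/negP.
    by apply: leq_ltn_trans B_gt2; case: (x != y).
  by rewrite !inE negb_or => zxy; exists z.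
have comm x z : x \in B -> z \in B -> K (tperm x z * tperm (k x) (k z)).
  move=> Bx Bz; rewrite -tpermJ conjgE -{1}[tperm x z]tpermV !mulgA.
  apply: KM => //; rewrite -mulgA -conjgE; apply: KJ; first exact: KV.
  exact: tperm_on_set.
(* A three-cycle lies in K as soon as some point outside x, k x is fixed by k
   or mapped to x. *)
have near x z : k x != x -> z \in B -> z != x -> z != k x ->
    (k z == z) || (k z == x) ->
  exists x y z, [/\ [/\ x \in B, y \in B & z \in B],
                    [/\ x != y, x != z & y != z] & C3 x y z].
  move=> kx Bz zx zkx kz; have Bx := Bk _ kx.
  have Bkx : k x \in B by rewrite (perm_closed _ (KB Kk)).
  move: (comm _ _ Bx Bz); case/orP: kz => /eqP->.
    rewrite (tpermC x) (tpermC (k x)) => C; exists z, x, (k x).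
    by split=> //; split=> //; rewrite eq_sym.
  rewrite (tpermC (k x)) => C; exists x, z, (k x).
  by split=> //; split=> //; rewrite eq_sym.
(* The remaining case is the involution without fixed points. *)
have [x [y [z [Bxyz Dxyz C]]]] : exists x y z,
    [/\ [/\ x \in B, y \in B & z \in B],
        [/\ x != y, x != z & y != z] & C3 x y z].
  have /existsP[x kx] : [exists x, k x != x].
    apply: contraLR odd_k; rewrite negb_exists => /forallP k1.
    suff -> : k = 1 by rewrite odd_perm1.
    by apply/permP=> x; rewrite perm1; apply/eqP; rewrite -[_ == _]negbK k1.
  have invol u : k u != u -> k (k u) != u -> exists x y z,
    [/\ [/\ x \in B, y \in B & z \in B],
        [/\ x != y, x != z & y != z] & C3 x y z].
    move=> ku kku; apply: (near (k u) u); rewrite ?(inj_eq perm_inj) ?Bk //.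
    - by rewrite eq_sym.
    - by rewrite eq_sym.
    - by rewrite eqxx orbT.
  have [/eqP kkx|] := boolP (k (k x) == x); last exact: invol.
  have [z Bz /andP[zx zkx]] := third x (k x).
  have [kz|kz] := boolP ((k z == z) || (k z == x)); first exact: near kz.
  move: kz; rewrite negb_or => /andP[kz kzx].
  have [/eqP kkz|] := boolP (k (k z) == z); last exact: invol.
  have Bx := Bk _ kx; have Bkx : k x \in B by rewrite (perm_closed _ (KB Kk)).
  have Bkz : k z \in B by rewrite (perm_closed _ (KB Kk)).
  (* k contains the 2-cycles (x k x) and (z k z), and is not their product as it
     is odd. *)
  have [/fintype.subsetP sub|] := boolP (B \subset [:: x; k x; z; k z]).
    suff ek : k = tperm x (k x) * tperm z (k z).
      have := congr1 (@odd_perm T) ek.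
      by rewrite odd_permM !odd_tperm odd_k (eq_sym x) (eq_sym z) kx kz.
    apply/permP=> u; rewrite permM.
    have [/sub|uB] := boolP (u \in B).
      rewrite !inE => /or4P[]/eqP->.
      + by rewrite tpermL tpermD // (inj_eq perm_inj) .
      + by rewrite tpermR kkx tpermD // eq_sym.
      + by rewrite [tperm x _ z]tpermD 1?eq_sym // tpermL.
      + rewrite [tperm x _ (k z)]tpermD 1?(inj_eq perm_inj) 1?eq_sym //.
        by rewrite tpermR kkz.
    have uD v : v \in B -> v != u by apply: contraTneq => ->.
    by rewrite !tpermD ?uD // (out_perm (KB Kk)).
  case/fintype.subsetPn=> u Bu; rewrite !inE !negb_or => /and4P[ux ukx uz ukz].
  have C := comm _ _ Bx Bz.
  have C' := KJ C (tperm_on_set Bx Bu).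
  rewrite conjMg !tpermJ tpermL !(@tpermD _ x u) // 1?eq_sym // in C'.
  exists z, x, u; split; [by []|by split=> //; rewrite eq_sym|].
  have := KM C (KV C'); rewrite invMg !tpermV mulgA.
  rewrite -(mulgA (tperm x z)) tperm2 mulg1 /C3.
  by rewrite (tpermC x) (tpermC u).
have C3all u v w : [/\ u \in B, v \in B & w \in B] ->
    [/\ u != v, u != w & v != w] -> C3 u v w.
  by move=> Buvw Duvw; apply: three_cycle_moved C.
have share u v w : [/\ u \in B, v \in B & w \in B] -> u != v -> u != w ->
    K (tperm u v * tperm u w).
  move=> Buvw uv uw; have [->|vw] := eqVneq v w; last exact: C3all.
  by rewrite tperm2.
have pair u v u' v' : u \in B -> v \in B -> u' \in B -> v' \in B ->
    u != v -> u' != v' -> K (tperm u v * tperm u' v').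
  move=> Bu Bv Bu' Bv' uv uv'.
  have [e|ne] := eqVneq u u'; first by rewrite -e in uv' *; apply: share.
  have := KM (share u v u' _ uv ne) (share u' u v' _ _ uv').
  rewrite -mulgA (mulgA (tperm u u')) (tpermC u' u) tperm2 mul1g; apply=> //.
  by rewrite eq_sym.
move=> s sB; case: Bxyz Dxyz => Bx By Bz [xy _ _].
(* Modulo K, a permutation depends only on its sign. *)
have H t : perm_on B t -> K (if odd_perm t then tperm x y * t else t).
  move: t; apply: (@perm_on_ind _ B
    (fun t : {perm T} => K (if odd_perm t then tperm x y * t else t))).
    by rewrite odd_perm1.
  move=> u v t Bu Bv uv tB IH; rewrite odd_permM odd_tperm uv /=.
  case: (odd_perm t) IH => /= IH.
    have := KM (pair u v x y Bu Bv Bx By uv xy) IH.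
    by rewrite -mulgA (mulgA (tperm x y)) tperm2 mul1g.
  by rewrite mulgA; apply: KM => //; apply: pair.
have Kt : K (tperm x y).
  by have := KM (H k (KB Kk)) (KV Kk); rewrite odd_k mulgK.
have := H s sB; case: odd_perm => // Ks.
by have := KM Kt Ks; rewrite mulgA tperm2 mul1g.
Qed.

End NormalOdd.

Section Subdirect.
Variables (T : finType) (A B : {set T}) (G : {perm T} -> {perm T} -> Prop).
Hypotheses (A_gt2 : 2 < #|A|) (B_gt2 : 2 < #|B|).
Hypothesis GM : forall s t s' t', G s t -> G s' t' -> G (s * s') (t * t').
Hypothesis GV : forall s t, G s t -> G s^-1 t^-1.
Hypothesis GB : forall s t, G s t -> perm_on B t.
Hypothesis projA : forall s, perm_on A s -> exists t, G s t.
Hypothesis projB : forall t, perm_on B t -> exists2 s, perm_on A s & G s t.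

(** The elements (1, t) of G form a normal subgroup in the second factor, so one
    odd t suffices. All transpositions of A are conjugate, hence lift to pairs
    whose second components have the same sign. If it is odd, then s0 has a
    lift with second component of sign equal to that of s0, to be compared with
    t0; if it is even, then every permutation of A has an even lift, to be
    compared with a lift of an odd permutation of B. *)
Lemma subdirect_sym_full s0 t0 :
    perm_on A s0 -> G s0 t0 -> odd_perm s0 != odd_perm t0 ->
  forall t, perm_on B t -> G 1 t.
Proof.
move=> s0A G0 neq0.
have G1 : G 1 1 by have := GM G0 (GV G0); rewrite !mulgV.
have two (S : {set T}) : 2 < #|S| -> exists x y, [/\ x \in S, y \in S & x != y].
  by move=> S_gt2; apply/card_gt1P/ltnW.
have [x [y [Ax Ay xy]]] := two _ A_gt2.
have [r Gr] := projA (tperm_on_set Ax Ay).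
have lift s : perm_on A s ->
    exists2 t, G s t & odd_perm t = odd_perm r && odd_perm s.
  move: s; apply: (@perm_on_ind _ A (fun s : {perm T} =>
    exists2 t, G s t & odd_perm t = odd_perm r && odd_perm s)).
    by exists 1; rewrite ?odd_perm1 ?andbF.
  move=> u v s Au Av uv sA [t Gst odd_t].
  have [c cA cxy] : exists2 c, perm_on A c & tperm x y ^ c = tperm u v.
    have uy' : tperm x u y != u.
      by exact: tperm_neqR.
    exists (tperm x u * tperm (tperm x u y) v).
      apply: perm_onM; first exact: tperm_on_set.
      by apply: tperm_on_set => //; rewrite (perm_closed _ (tperm_on_set _ _)).
    by rewrite conjgM !tpermJ tpermL tpermL tpermD // eq_sym.
  have [d Gcd] := projA cA.
  have Gcr : G (tperm u v) (r ^ d).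
    by rewrite -cxy !conjgE; apply: GM; [apply: GV|apply: GM].
  exists (r ^ d * t); first exact: GM.
  have odd_rd : odd_perm (r ^ d) = odd_perm r by exact: odd_permJ.
  rewrite (odd_permM (r ^ d)) odd_rd odd_permM odd_t odd_tperm uv.
  by case: odd_perm; case: odd_perm.
have [k Gk odd_k] : exists2 k, G 1 k & odd_perm k.
  have div s t t' : G s t -> G s t' -> odd_perm t != odd_perm t' ->
      exists2 k, G 1 k & odd_perm k.
    move=> Gst Gst' neq; exists (t * t'^-1).
      by have := GM Gst (GV Gst'); rewrite mulgV.
    by rewrite odd_permM odd_permV; case: odd_perm neq; case: odd_perm.
  have [odd_r|even_r] := boolP (odd_perm r).
    have [t Gt odd_t] := lift _ s0A; apply: div G0 Gt _.
    by rewrite odd_t odd_r eq_sym.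
  have [u [v [Bu Bv uv]]] := two _ B_gt2.
  have [s sA Gs] := projB (tperm_on_set Bu Bv).
  have [t Gt odd_t] := lift _ sA; apply: div Gs Gt _.
  by rewrite odd_t (negPf even_r) odd_tperm uv.
apply: (@odd_normal_full _ B (G 1)) Gk odd_k => //.
- by move=> s t Gs Gt; rewrite -(mulg1 1); apply: GM.
- by move=> s Gs; rewrite -invg1; apply: GV.
- move=> s t Gs tB; have [u _ Gu] := projB tB.
  by rewrite -(conj1g u) !conjgE; apply: GM; [apply: GV|apply: GM].
- by move=> s; apply: GB.
Qed.

End Subdirect.

(** * The dual action on words *)

Section Dual.
Variables (Q : finType) (a b : Q) (pi : {perm Q}) (chi : Q -> bool).
Hypotheses (chi_a : chi a) (chi_b : chi b).

Implicit Types (p q z : Q) (s x y : bool) (w u : seq (Q * bool)).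

(** The next-state map for the letter y; it is also the next-state map of the
    inverses of the states for the letter ~~ y. *)
Definition turn y : {perm Q} := if y then tperm a b * pi else pi.

(** The word left after the bit x has gone through the letters of w, the head
    first; a letter (q, s) stands for q, or for its inverse if s holds, and
    flips the bit if chi q holds. *)
Fixpoint dual x w :=
  if w is l :: u then (turn (x (+) l.2) l.1, l.2) :: dual (x (+) chi l.1) u
  else [::].

Definition parity w := foldr (fun l r => chi l.1 (+) r) false w.

Lemma turn_fixed q y : q != a -> q != b -> turn y q = pi q.
Proof. by move=> qa qb; case: y => //=; rewrite permM tpermD // eq_sym. Qed.

(** A bit changes under q exactly by chi q, and turn depends on the bit only at
    a and b, which flip it. This is why the words keep being reduced and why the
    dual action may be read backwards. *)
Lemma turn_chi q y : turn (chi q (+) y) q = turn (~~ y) q.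
Proof.
have [//|nchi] := boolP (chi q); rewrite !turn_fixed //.
- by apply: contraNneq nchi => ->.
- by apply: contraNneq nchi => ->.
- by apply: contraNneq nchi => ->.
- by apply: contraNneq nchi => ->.
Qed.

Lemma parity_cat w u : parity (w ++ u) = parity w (+) parity u.
Proof. by elim: w => //= l w ->; rewrite addbA. Qed.

Lemma parity_rcons w l : parity (rcons w l) = parity w (+) chi l.1.
Proof. by rewrite -cats1 parity_cat /= addbF. Qed.

Lemma parity_rev w : parity (rev w) = parity w.
Proof. by elim: w => //= l w IH; rewrite rev_cons parity_rcons IH addbC. Qed.

Lemma dual_size x w : size (dual x w) = size w.
Proof. by elim: w x => //= l w IH x; rewrite IH. Qed.

Lemma dual_signs x w : map snd (dual x w) = map snd w.
Proof. by elim: w x => //= l w IH x; rewrite IH. Qed.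

Lemma dual_rcons x w q s : dual x (rcons w (q, s)) =
  rcons (dual x w) (turn (x (+) parity w (+) s) q, s).
Proof.
by elim: w x => [|l w IH] x /=; rewrite ?addbF // IH addbA.
Qed.

Lemma dual_inj x : injective (dual x).
Proof.
move=> w; elim: w x => [|[q s] w IH] x [|[q' s'] w'] //= [+ ss].
rewrite -ss => /perm_inj qq; rewrite -qq => /IH ->; by [].
Qed.

(** The dual action commutes with reversal, up to the choice of the initial bit:
    all statements below are symmetric in left and right. *)
Lemma dual_rev x w : rev (dual x w) = dual (~~ (x (+) parity w)) (rev w).
Proof.
elim: w x => [|[q s] w IH] x //=; rewrite !rev_cons dual_rcons IH parity_rev.
congr rcons; first by rewrite addbA.
congr pair; have -> : ~~ (x (+) (chi q (+) parity w)) (+) parity w (+) s =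
  chi q (+) ~~ (x (+) s).
  by case: (chi q); case: (parity w); case: x; case: s.
by rewrite turn_chi negbK.
Qed.

(** This describes the letters that may be put in front of w; those that may be
    appended at the end are obtained through [rev]. *)
Definition allowed w s : {set Q} :=
  if w is l :: _ then if s == l.2 then [set: Q] else [set~ l.1] else [set: Q].

Lemma reduced_cons q s w :
  reduced ((q, s) :: w) = (q \in allowed w s) && reduced w.
Proof.
case: w => [|[q' s'] w] /=; first by rewrite inE.
by rewrite /reduced /=; case: (s =P s') => _ /=; rewrite ?andbF ?andbT ?inE.
Qed.

Lemma reduced_rev w : reduced (rev w) = reduced w.
Proof.
rewrite /reduced rev_sorted; apply: eq_sorted => l k /=.
by rewrite eq_sym (eq_sym k.2).
Qed.

Lemma reduced_rcons q s w :
  reduced (rcons w (q, s)) = (q \in allowed (rev w) s) && reduced w.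
Proof. by rewrite -reduced_rev rev_rcons reduced_cons reduced_rev. Qed.

(** At adjacent letters q and q' with opposite signs, the indices of turn are y
    and chi q + 1 + y for some y. By turn_chi both maps take the same value at q,
    so the images coincide if and only if q = q'. *)
Lemma reduced_dual x w : reduced (dual x w) = reduced w.
Proof.
elim: w x => [|[q s] w IH] x //=; rewrite !reduced_cons IH; congr andb.
case: w {IH} => [|[q' s'] w] /=; first by rewrite !inE.
have [ss|ss] := eqVneq s s'; first by rewrite !inE.
rewrite !inE; congr negb.
have -> : x (+) chi q (+) s' = chi q (+) ~~ (x (+) s).
  by case: (chi q); case: x; case: s ss; case: s'.
have e : turn (x (+) s) q = turn (chi q (+) ~~ (x (+) s)) q.
  by rewrite turn_chi negbK.
by rewrite e (inj_eq perm_inj).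
Qed.

Lemma allowed_cases w s :
  allowed w s = [set: Q] \/ exists z, allowed w s = [set~ z].
Proof.
case: w => [|l w] /=; first by left.
by case: ifP => _; [left|right; exists l.1].
Qed.

(** The orbit groupoid of the dual action. A path from w to w' extends to the
    words obtained by adding a letter of sign sL in front or of sign sR at the
    end; al and be are the permutations of the states of these extra letters.
    The bit x entering w corresponds to the bit x + chi p before a letter p in
    front, hence the negation in the left permutation. *)
Inductive moves (sL sR : bool) :
    seq (Q * bool) -> seq (Q * bool) -> {perm Q} -> {perm Q} -> Prop :=
| moves_refl w : moves sL sR w w 1 1
| moves_dual x w :
    moves sL sR w (dual x w) (turn (~~ x (+) sL)) (turn (x (+) parity w (+) sR))
| moves_sym w w' al be : moves sL sR w w' al be -> moves sL sR w' w al^-1 be^-1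
| moves_trans w1 w2 w3 al be al' be' :
    moves sL sR w1 w2 al be -> moves sL sR w2 w3 al' be' ->
    moves sL sR w1 w3 (al * al') (be * be').

Lemma moves_cons sL sR s w w' al be p :
    moves sL sR w w' al be ->
  exists al', moves s sR ((p, sL) :: w) ((al p, sL) :: w') al' be.
Proof.
move=> ww'; elim: ww' p => [{}w|x {}w|{}w {}w' {}al {}be _ IH|
                            w1 w2 w3 {}al {}be al' be' _ IH1 _ IH2] p.
- by exists 1; rewrite perm1; apply: moves_refl.
- exists (turn (~~ (chi p (+) x) (+) s)).
  have := moves_dual s sR (chi p (+) x) ((p, sL) :: w); rewrite /=.
  have -> : chi p (+) x (+) chi p = x by case: (chi p); case: x.
  have -> : chi p (+) x (+) (chi p (+) parity w) = x (+) parity w.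
    by case: (chi p); case: x; case: (parity w).
  by rewrite -addbA turn_chi -addNb.
- by have [al' /moves_sym] := IH (al^-1 p); rewrite permKV => h; exists al'^-1.
- have [g h1] := IH1 p; have [g' h2] := IH2 (al p).
  by exists (g * g'); rewrite permM; apply: moves_trans h2.
Qed.

Lemma moves_rev sL sR w w' al be :
  moves sL sR w w' al be -> moves sR sL (rev w) (rev w') be al.
Proof.
elim=> {w w' al be} [w|x w|w w' al be _ IH|w1 w2 w3 al be al' be' _ IH1 _ IH2].
- exact: moves_refl.
- rewrite dual_rev; have := moves_dual sR sL (~~ (x (+) parity w)) (rev w).
  by rewrite parity_rev negbK -addNb -(addbA (~~ x)) addbb addbF.
- exact: moves_sym.
- exact: moves_trans IH2.
Qed.

Lemma moves_rcons sL sR s w w' al be q :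
    moves sL sR w w' al be ->
  exists be', moves sL s (rcons w (q, sR)) (rcons w' (be q, sR)) al be'.
Proof.
move=> /moves_rev /(moves_cons s q) [be' /moves_rev]; rewrite !rev_cons !revK.
by exists be'.
Qed.

Lemma moves_signs sL sR w w' al be :
  moves sL sR w w' al be -> map snd w' = map snd w.
Proof.
by elim=> // [x {}w|{}w1 w2 w3 {}al {}be al' be' _ <- _ //]; rewrite dual_signs.
Qed.

Lemma moves_size sL sR w w' al be : moves sL sR w w' al be -> size w' = size w.
Proof. by move/moves_signs/(congr1 size); rewrite !size_map. Qed.

Lemma moves_reduced sL sR w w' al be :
  moves sL sR w w' al be -> reduced w' = reduced w.
Proof.
by elim=> // [x {}w|{}w1 w2 w3 {}al {}be al' be' _ <- _ //]; rewrite reduced_dual.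
Qed.

Lemma moves_allowed_left sL sR w w' al be :
    moves sL sR w w' al be -> reduced w ->
  forall p, (al p \in allowed w' sL) = (p \in allowed w sL).
Proof.
move=> ww' rw p; have [al' ] := moves_cons sL p ww'.
by move/moves_reduced; rewrite !reduced_cons (moves_reduced ww') rw !andbT.
Qed.

Lemma moves_allowed_right sL sR w w' al be :
    moves sL sR w w' al be -> reduced w ->
  forall q, (be q \in allowed (rev w') sR) = (q \in allowed (rev w) sR).
Proof.
by move=> ww' rw; apply: (moves_allowed_left (moves_rev ww')); rewrite reduced_rev.
Qed.

Lemma loop_perm_on sL sR w al be :
  moves sL sR w w al be -> reduced w -> perm_on (allowed w sL) al.
Proof.
move=> ww rw; have := moves_allowed_left ww rw.
have [->|[z ->]] := allowed_cases w sL; first by move=> _; apply: perm_on_setT.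
by move/(_ z); rewrite perm_onC1 !inE eqxx => /negbFE.
Qed.

Definition transitive_on m := forall w w' sL sR,
  size w = m -> reduced w -> reduced w' -> map snd w' = map snd w ->
  exists al be, moves sL sR w w' al be.

Definition locally_full m := forall w sL sR be,
  size w = m -> reduced w -> perm_on (allowed (rev w) sR) be ->
  exists al, moves sL sR w w al be.

(** Move the word without its last letter by transitivity, then correct the last
    letter by a loop inducing a transposition. *)
Lemma transitive_step m :
  locally_full m -> transitive_on m -> transitive_on m.+1.
Proof.
move=> full trans; case/lastP=> [//|w [q s]]; case/lastP=> [|w' [q' s']] sL sR.
  by rewrite map_rcons; case: (map snd w).
rewrite size_rcons !map_rcons !reduced_rcons => -[size_w].
move=> /andP[qw rw] /andP[q'w' rw'] /rcons_inj[ww' /= ss]; rewrite ss in q'w' *.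
have [al [be /[dup] ww]] := trans w w' sL s size_w rw rw' ww'.
move/(moves_rcons sR q) => [be1 h1].
have beq : be q \in allowed (rev w') s by rewrite (moves_allowed_right ww).
have size_w' : size w' = m by rewrite (moves_size ww).
have [al2 h2] := full w' sL s _ size_w' rw' (tperm_on_set beq q'w').
have [be2 ] := moves_rcons sR (be q) h2; rewrite tpermL => h.
by exists (al * al2), (be1 * be2); apply: moves_trans h.
Qed.

Hypotheses (ab : a != b) (pi_b : pi b = b).
Hypothesis pi_trans : forall q, q != b -> exists k, q = (pi ^+ k) a.
Hypotheses (Q_gt3 : 3 < #|Q|) (Q_even : ~~ odd #|Q|).
Hypothesis chi_odd : \big[addb/false]_q chi q = true.

Lemma card_allowed w s : 2 < #|allowed w s|.
Proof.
have [->|[z ->]] := allowed_cases w s; first by rewrite cardsT ltnW.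
by rewrite cardsC1; move: Q_gt3; case: #|Q|.
Qed.

(** The permutations reached form a group that contains pi and (a b), hence also
    the transpositions (q b) for all q, as pi fixes b and carries a to every
    other state. *)
Lemma locally_full0 : locally_full 0.
Proof.
case=> // sL sR be _ _ _.
pose G be := exists al, moves sL sR [::] [::] al be.
have G1 : G 1 by exists 1; apply: moves_refl.
have GM t t' : G t -> G t' -> G (t * t').
  by move=> [s h] [s' h']; exists (s * s'); apply: moves_trans h'.
have GV t : G t -> G t^-1 by move=> [s h]; exists s^-1; apply: moves_sym.
have Gturn y : G (turn y).
  exists (turn (~~ (y (+) sR) (+) sL)); have := moves_dual sL sR (y (+) sR) [::].
  by rewrite /= addbF -addbA addbb addbF.
have Gab : G (tperm a b).
  by have := GM _ _ (Gturn true) (GV _ (Gturn false)); rewrite /= mulgK.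
have Gpi k : G (pi ^+ k).
  elim: k => [|k IH]; first by rewrite expg0.
  by rewrite expgS; apply: (GM) => //; apply: (Gturn false).
have pikb k : (pi ^+ k) b = b.
  by rewrite permX; elim: k => //= k ->.
have Gstar q : q != b -> G (tperm q b).
  case/pi_trans=> k ->; rewrite -[X in tperm _ X](pikb k) -tpermJ conjgE.
  by apply: (GM); [apply: (GV)|apply: (GM)].
have Gtperm q r : q != r -> G (tperm q r).
  have [->|qb] := eqVneq q b; first by rewrite eq_sym tpermC; apply: Gstar.
  have [->|rb] := eqVneq r b; first by move=> _; apply: Gstar.
  move=> qr; have -> : tperm q r = tperm q b ^ tperm r b.
    by rewrite tpermJ tpermR tpermD // eq_sym.
  by rewrite conjgE; apply: (GM); [apply: (GV)|apply: (GM)]; apply: Gstar.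
apply: (@perm_on_ind _ [set: Q] G _ _ be (perm_on_setT be)) => //.
by move=> q r t _ _ qr _; apply: (GM); apply: Gtperm.
Qed.

(** The mask c selects the letters whose chi occurs in the affine function with
    constant term c0. *)
Definition no_coboundary m :=
  forall (sg c : seq bool) c0 (f : seq (Q * bool) -> bool),
  size sg = m -> size c = m ->
  (forall x w, reduced w -> map snd w = sg ->
     f (dual x w) (+) f w = c0 (+) parity (mask c w)) ->
  c0 = false /\ c = nseq m false.

Lemma no_coboundary0 : no_coboundary 0.
Proof.
case=> [] // [] // c0 f _ _ /(_ false [::] isT erefl) /=.
by rewrite addbb addbF => <-.
Qed.

Lemma odd_turn y : odd_perm (turn y) = y (+) odd_perm pi.
Proof. by case: y => //=; rewrite odd_permM odd_tperm ab. Qed.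

(** If no loop at w had this property, then the product of the two signs along
    paths starting at w would be a potential f whose coboundary is
    1 + sL + sR + parity. The excluded case is the empty word between opposite
    signs, where the left and right permutations coincide. *)
Lemma sign_defect m w sL sR :
    transitive_on m -> no_coboundary m -> size w = m -> reduced w ->
    (0 < m) || (sL == sR) ->
  exists al be, moves sL sR w w al be /\ odd_perm al != odd_perm be.
Proof.
move=> trans rig size_w rw ok; apply: contrapT => none.
have eq_odd al be : moves sL sR w w al be -> odd_perm al = odd_perm be.
  move=> h; apply/eqP; apply: contrapT => /negP ne; apply: none.
  by exists al, be.
pose f u := `[< exists al be, moves sL sR w u al be /\
                  odd_perm al (+) odd_perm be >].
have fE u al be : moves sL sR w u al be -> f u = odd_perm al (+) odd_perm be.
  move=> h; apply/asboolP/idP=> [[al' [be' [h' odd']]]|]; last by exists al, be.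
  have := eq_odd _ _ (moves_trans h' (moves_sym h)).
  rewrite !odd_permM !odd_permV.
  by move: odd'; do 4![case: odd_perm].
have := rig (map snd w) (nseq m true) (~~ (sL (+) sR)) f.
rewrite size_map size_nseq => /(_ size_w erefl) [|e1 e2].
  move=> x u ru uw; have [al [be h]] := trans w u sL sR size_w rw ru uw.
  rewrite (fE _ _ _ h) (fE _ _ _ (moves_trans h (moves_dual sL sR x u))).
  rewrite mask_true; last by rewrite -size_w -(moves_size h).
  rewrite !odd_permM !odd_turn.
  move: (odd_perm al) (odd_perm be) (odd_perm pi) (parity u) => t1 t2 t3 t4.
  by case: x sL sR t1 t2 t3 t4 {ok none eq_odd f fE h} => [] [] [] [] [] [] [].
case/orP: ok => [m_gt0|/eqP e]; last by rewrite e addbb in e1.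
by case: m m_gt0 e2 {trans rig size_w}.
Qed.

(** The loops at w that fix every letter in front of w still induce all
    permutations of the allowed letters after w. *)
Lemma full_right m w sL sR be :
    locally_full m -> transitive_on m -> no_coboundary m ->
    size w = m -> reduced w ->
    (0 < m) || (sL == sR) -> perm_on (allowed (rev w) sR) be ->
  moves sL sR w w 1 be.
Proof.
move=> full trans rig size_w rw ok be_on.
have [al0 [be0 [h0 ne0]]] := sign_defect trans rig size_w rw ok.
apply: (subdirect_sym_full (card_allowed w sL) (card_allowed (rev w) sR)
  (G := moves sL sR w w) _ _ _ _ _ (loop_perm_on h0 rw) h0 ne0) => //.
- by move=> s t s' t' h h'; apply: moves_trans h'.
- by move=> s t; apply: moves_sym.
- by move=> s t /moves_rev/loop_perm_on; rewrite reduced_rev; apply.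
- move=> s s_on; have := full (rev w) sR sL s; rewrite size_rev reduced_rev revK.
  by move=> /(_ size_w rw s_on) [t /moves_rev]; rewrite !revK; exists t.
- move=> t /(full w sL sR t size_w rw) [s h]; exists s => //.
  exact: loop_perm_on h rw.
Qed.

Lemma moves_nil_diag sL sR w w' al be :
  moves sL sR w w' al be -> sL != sR -> w = [::] -> w' = [::] /\ al = be.
Proof.
move=> h ne.
have nilE : w' = [::] <-> w = [::].
  by split=> e; apply: size0nil; move/moves_size: h; rewrite e.
elim: h => {w w' al be nilE} [w|x w ->|w w' al be h IH|
   w1 w2 w3 al be al' be' _ IH1 _ IH2] /=.
- by move=> ->.
- by rewrite addbF; split=> //; congr turn; case: x sL sR ne => [] [] [].
- move=> e; have w0 : w = [::] by apply: size0nil; rewrite -(moves_size h) e.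
  by have [_ ->] := IH w0.
- by move=> /IH1[/IH2[-> ->] ->].
Qed.

(** Putting p in front of w, the loops at w given by full_right become loops at
    p w. For a single letter p followed by the opposite sign, the left and right
    permutations of the empty word coincide, so a permutation fixing p is
    realised by a loop fixing p. *)
Lemma locally_full_step m :
  locally_full m -> transitive_on m -> no_coboundary m -> locally_full m.+1.
Proof.
move=> full trans rig [//|[p s] w] sL sR be [size_w].
rewrite reduced_cons => /andP[_ rw].
have [ok|] := boolP ((0 < m) || (s == sR)).
  have -> : allowed (rev ((p, s) :: w)) sR = allowed (rev w) sR.
    rewrite rev_cons; case: w size_w {rw} => [/= m0|l w _].
      by move: ok; rewrite -m0 /= eq_sym => ->.
    by rewrite rev_cons; case: (rev w).
  move=> be_on; have h := full_right full trans rig size_w rw ok be_on.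
  by have := moves_cons sL p h; rewrite perm1.
rewrite negb_or -eqn0Ngt => /andP[/eqP m0 ssR].
have w0 : w = [::] by apply: size0nil; rewrite size_w.
rewrite w0 /= eq_sym (negPf ssR) perm_onC1 => /eqP bep.
have [al h] := full [::] s sR be (esym m0) isT (perm_on_setT be).
have [_ e] := moves_nil_diag h ssR erefl.
by have := moves_cons sL p h; rewrite e bep.
Qed.

Lemma nseq_rcons (T : Type) k (x : T) : rcons (nseq k x) x = nseq k.+1 x.
Proof. by elim: k => //= k ->. Qed.

Lemma big_addb_const (T : finType) (P : pred T) e :
  \big[addb/false]_(i | P i) e = odd #|P| && e.
Proof.
by rewrite big_const; elim: #|P| => //= n ->; case: (odd n); case: e.
Qed.

Lemma big_turn y (A A' : {set Q}) (F : Q -> bool) :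
  (forall q, (turn y q \in A') = (q \in A)) ->
  \big[addb/false]_(q in A') F q = \big[addb/false]_(q in A) F (turn y q).
Proof.
by move=> AA'; rewrite (reindex_inj (@perm_inj _ (turn y))); apply: eq_bigl.
Qed.

Lemma chi_sum_allowed w s : \big[addb/false]_(q in allowed w s) chi q =
  (if w is l :: _ then (s != l.2) && chi l.1 else false) (+) true.
Proof.
case: w => [|l w] /=; first by rewrite -chi_odd; apply: eq_bigl => q; rewrite inE.
case: eqP => _ /=; first by rewrite -chi_odd; apply: eq_bigl => q; rewrite inE.
rewrite -chi_odd [in RHS](bigD1 l.1) //= addbA addbb.
by apply: eq_bigl => q; rewrite !inE.
Qed.

Lemma odd_allowed w s :
  odd #|allowed w s| = if w is l :: _ then s != l.2 else false.
Proof.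
case: w => [|l w] /=; first by rewrite cardsT (negPf Q_even).
case: eqP => _; rewrite ?cardsT ?cardsC1 ?(negPf Q_even) //.
by move: Q_even Q_gt3; case: #|Q| => //= n; rewrite negbK => ->.
Qed.

(** A coboundary on words of length m + 1, where e tells whether the last letter
    occurs in it. *)
Section LastLetter.
Variables (m : nat) (sg c : seq bool) (s c0 e : bool).
Variable f : seq (Q * bool) -> bool.
Hypotheses (size_sg : size sg = m) (size_c : size c = m).
Hypothesis fE : forall x w, reduced w -> map snd w = rcons sg s ->
  f (dual x w) (+) f w = c0 (+) parity (mask (rcons c e) w).

Let f_rcons x w q : reduced w -> map snd w = sg -> q \in allowed (rev w) s ->
  f (rcons (dual x w) (turn (x (+) parity w (+) s) q, s)) =
  f (rcons w (q, s)) (+) (c0 (+) parity (mask c w) (+) (e && chi q)).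
Proof.
move=> rw sw qw; have sz : size c = size w.
  by rewrite size_c -size_sg -sw size_map.
have := fE x (w := rcons w (q, s)).
rewrite reduced_rcons qw rw map_rcons sw => /(_ isT erefl).
rewrite mask_rcons // parity_cat dual_rcons.
have -> : parity (nseq e (q, s)) = e && chi q by case: (e); rewrite /= ?addbF.
by rewrite addbA => <-; rewrite addbCA addbb addbF.
Qed.

(** A loop at w adds the same constant to f for all last letters. For a loop
    inducing a transposition the constant is 0, because a third allowed letter
    is fixed; so f does not depend on the last letter. *)
Lemma no_coboundary_last_false : e = false -> locally_full m -> no_coboundary m ->
  c0 = false /\ c = nseq m false.
Proof.
move=> e0 full rig.
have loop sL w w' al be : moves sL s w w' al be -> reduced w -> map snd w = sg ->
    exists k, forall q, q \in allowed (rev w) s ->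
      f (rcons w' (be q, s)) = f (rcons w (q, s)) (+) k.
  elim=> {w w' al be} [w|x w|w w' al be h IH|
                       w1 w2 w3 al be al' be' h1 IH1 h2 IH2].
  - by move=> _ _; exists false => q _; rewrite perm1 addbF.
  - move=> rw sw; exists (c0 (+) parity (mask c w)) => q qw.
    by rewrite f_rcons // e0 addbF.
  - rewrite (moves_reduced h) (moves_signs h) => rw sw; have [k kE] := IH rw sw.
    exists k => q; rewrite -{1}(permKV be q) (moves_allowed_right h) // => qw.
    by rewrite -{2}(permKV be q) kE // -addbA addbb addbF.
  - move=> rw sw; have [k kE] := IH1 rw sw.
    rewrite (moves_reduced h1) (moves_signs h1) in IH2; have [k' kE'] := IH2 rw sw.
    exists (k (+) k') => q qw; rewrite permM kE' ?(moves_allowed_right h1) // kE //.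
    by rewrite addbA.
have fconst w q q' : reduced w -> map snd w = sg ->
    q \in allowed (rev w) s -> q' \in allowed (rev w) s ->
    f (rcons w (q, s)) = f (rcons w (q', s)).
  move=> rw sw qw q'w.
  have size_w : size w = m by rewrite -size_sg -sw size_map.
  have [->//|qq'] := eqVneq q q'.
  have [r rF rqq'] : exists2 r, r \in allowed (rev w) s & r \notin [set q; q'].
    apply/fintype.subsetPn/negP => /subset_leq_card; rewrite cards2 qq' leqNgt.
    by rewrite card_allowed.
  move: rqq'; rewrite !inE negb_or => /andP[rq rq'].
  have [al h] := full w false s _ size_w rw (tperm_on_set qw q'w).
  have [k kE] := loop _ _ _ _ _ h rw sw.
  have := kE r rF; rewrite tpermD 1?eq_sym // => k0.
  have := kE q qw; rewrite tpermL => ->.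
  by move: k0; case: k kE; rewrite ?addbF //; case: (f _).
pose F w := [exists q in allowed (rev w) s, f (rcons w (q, s))].
have FE w q : reduced w -> map snd w = sg -> q \in allowed (rev w) s ->
    F w = f (rcons w (q, s)).
  move=> rw sw qw; apply/existsP/idP => [[r /andP[rF]]|fq].
    by rewrite (fconst _ _ q).
  by exists q; rewrite qw.
apply: (rig sg c c0 F) => // x w rw sw.
have /card_gt0P[q qw] : 0 < #|allowed (rev w) s|.
  by rewrite ltnW // ltnW // card_allowed.
rewrite (FE w q) // (FE (dual x w) (turn (x (+) parity w (+) s) q)).
- by rewrite f_rcons // e0 addbF addbC addbA addbb.
- by rewrite reduced_dual.
- by rewrite dual_signs.
- by rewrite (moves_allowed_right (moves_dual false s x w)).
Qed.

(** The sum F of f over the allowed last letters is a potential on words of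
    length m. All states are allowed if the last two signs agree: then the
    coboundary of F is the constant 1. Otherwise the last state z is excluded
    and the coboundary of F is c0 + 1 + chi z plus the terms of c. *)
Lemma coboundary_last_true : e = true -> no_coboundary m ->
  exists k, [/\ m = k.+1, c0, c = rcons (nseq k false) true & last s sg != s].
Proof.
move=> e1 rig.
pose F w := \big[addb/false]_(q in allowed (rev w) s) f (rcons w (q, s)).
have FE x w : reduced w -> map snd w = sg -> F (dual x w) (+) F w =
    odd #|allowed (rev w) s| && (c0 (+) parity (mask c w)) (+)
    \big[addb/false]_(q in allowed (rev w) s) chi q.
  move=> rw sw; rewrite /F.
  rewrite (big_turn (y := x (+) parity w (+) s) (A := allowed (rev w) s)); last first.
    by move=> q; rewrite (moves_allowed_right (moves_dual false s x w)).
  rewrite -big_addb_const -!big_split /=; apply: eq_bigr => q qw.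
  by rewrite f_rcons // e1 addbC addbA addbb.
(* In the first case all states are allowed as last letter. *)
have [same|diff] := boolP (nilp sg || (last s sg == s)).
  have [|//] := rig sg (nseq m false) true F size_sg (size_nseq _ _).
  move=> x w rw sw; rewrite FE // odd_allowed chi_sum_allowed mask_false /=.
  move: same; rewrite -sw; case/lastP: w {rw sw} => [//|w [q t]].
  rewrite map_rcons last_rcons rev_rcons /= => /orP[|/eqP->]; last by rewrite eqxx.
  by rewrite /nilp size_rcons.
move: diff; rewrite negb_or => /andP[nn ne].
case/lastP: sg size_sg nn ne FE => [//|sg' t].
rewrite size_rcons last_rcons => mE _ ts FE.
case/lastP: c size_c FE => [|c' d]; first by rewrite -mE.
rewrite size_rcons => cE FE.
have := rig (rcons sg' t) (rcons c' (~~ d)) (~~ c0) F.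
rewrite !size_rcons => /(_ mE cE) [|c00 cE'].
  move=> x w rw sw; rewrite FE //; case/lastP: w rw sw => [_|w [q t'] _].
    by case: (sg').
  rewrite map_rcons => /rcons_inj[sw /= tt].
  have sz : size c' = size w.
    apply/eqP; rewrite -eqSS cE -mE eqSS -(size_map snd w) sw; exact/eqP.
  rewrite odd_allowed chi_sum_allowed rev_rcons /= tt eq_sym ts /=.
  rewrite !mask_rcons // !parity_cat.
  by case: (d); rewrite /= ?addbF; case: (c0); case: (chi q); case: (parity _).
exists (size sg'); split=> //.
- by case: (c0) c00.
- move: cE'; rewrite -mE -nseq_rcons => /rcons_inj[-> /negbFE ->]; by [].
Qed.

End LastLetter.

(** Take a flipping state p0 = pi^d a other than a and b, and the pairs
    (pi^d q, q) with q <> b. On them [dual (~~ s)] acts as pi on both letters: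
    the index of turn is 0 at the first one, and matters at the second one only
    if q = a, when the first letter is p0 and flips the bit, so that the index
    is 0 again. The number of these pairs is odd, and each state but b occurs
    once in either position, so the sum of 1 + chi + chi over them is 1; but the
    sum of a coboundary over a set permuted by [dual (~~ s)] is 0. *)
Lemma pair_not_coboundary s (f : seq (Q * bool) -> bool) :
  ~ (forall x w, reduced w -> map snd w = [:: ~~ s; s] ->
       f (dual x w) (+) f w = true (+) parity w).
Proof.
move=> fE.
have [p0 [p0a p0b chi_p0]] : exists p0, [/\ p0 != a, p0 != b & chi p0].
  apply: contrapT => none; move: chi_odd.
  rewrite (bigD1 a) //= (bigD1 b) 1?eq_sym //= chi_a chi_b big1 // => q.
  move=> /andP[qa qb]; apply/negbTE/negP => cq; apply: none.
  by exists q.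
have [d p0E] := pi_trans p0b.
pose r := pi ^+ d.
have rb : r b = b by rewrite /r permX; elim: (d) => //= k ->.
have rC q : r (pi q) = pi (r q) by rewrite -!permM /r -expgSr -expgS.
have r_nofix q : q != b -> r q != q.
  case/pi_trans=> k ->; rewrite -permM /r -expgD addnC expgD permM.
  by rewrite (inj_eq perm_inj) -p0E.
pose F q := f [:: (r q, ~~ s); (q, s)].
have step q : q != b -> F (pi q) (+) F q = true (+) (chi (r q) (+) chi q).
  move=> qb; have := fE (~~ s) [:: (r q, ~~ s); (q, s)].
  rewrite /= addbF addbb /= /F rC => <- //.
    congr addb; congr (f [:: _; (_, _)]).
    have [->|qa] := eqVneq q a; last by rewrite turn_fixed.
    have -> : ~~ s (+) chi (r a) (+) s = false.
      by rewrite -p0E chi_p0; case: (s).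
    by [].
  rewrite reduced_cons /= reduced_cons !inE /= andbT.
  by case: (s) => /=; rewrite !inE r_nofix.
have Fpi : \big[addb/false]_(q | q != b) F (pi q) =
           \big[addb/false]_(q | q != b) F q.
  rewrite [RHS](reindex_inj (@perm_inj _ pi)); apply: eq_bigl => q.
  by rewrite -{2}pi_b (inj_eq perm_inj).
have chir : \big[addb/false]_(q | q != b) chi (r q) =
            \big[addb/false]_(q | q != b) chi q.
  rewrite [RHS](reindex_inj (@perm_inj _ r)); apply: eq_bigl => q.
  by rewrite -{2}rb (inj_eq perm_inj).
have := erefl (\big[addb/false]_(q | q != b) (F (pi q) (+) F q)).
rewrite {1}big_split /= Fpi addbb (eq_bigr _ step) !big_split /= chir addbb.
rewrite big_addb_const addbF andbT.
have -> : #|[pred q | q != b]| = #|Q|.-1 by rewrite -(cardC1 b).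
by move: Q_even Q_gt3; case: #|Q| => //= n; rewrite negbK => ->.
Qed.

(** In the case left by coboundary_last_true the function is 1 + chi + chi in
    the last two letters; on reversed words it involves the first two only. *)
Lemma no_coboundary_step m : locally_full m -> no_coboundary m -> no_coboundary m.+1.
Proof.
move=> full rig sg c c0 f.
case/lastP: sg => // sg s; case/lastP: c => // c e.
rewrite !size_rcons => -[size_sg] [size_c] fE.
case: e fE => fE; last first.
  have [-> ->] := no_coboundary_last_false size_sg size_c fE erefl full rig.
  by rewrite nseq_rcons.
have [k [mE c0T cE ne]] := coboundary_last_true size_sg size_c fE erefl rig.
exfalso.
pose f' w := f (rev w).
have f'E x w : reduced w -> map snd w = s :: rev sg ->
    f' (dual x w) (+) f' w = c0 (+) parity (mask (true :: true :: nseq k false) w).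
  move=> rw sw; rewrite /f' dual_rev fE; first last.
  - by rewrite map_rev sw rev_cons revK.
  - by rewrite reduced_rev.
  have sz : size w = k.+2.
    by rewrite -(size_map snd) sw /= size_rev size_sg mE.
  rewrite cE -[w in RHS]revK -[_ :: _ :: _]revK -rev_mask; last first.
    by rewrite !size_rev sz /= size_nseq.
  by rewrite parity_rev !rev_cons rev_nseq.
case: k mE cE f'E => [|k] mE cE f'E.
  have [t sgE] : exists t, sg = [:: t].
    by move: size_sg; rewrite mE; case: (sg) => [|t []] //; exists t.
  apply: (@pair_not_coboundary (~~ s) f') => x w rw; rewrite negbK => sw.
  rewrite f'E // ?c0T ?sgE ?sw //; last first.
    by move: ne; rewrite sgE /=; case: (t) (s) => [] [].
  by case: w sw {rw} => [|l [|l' []]].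
have sgE : s :: rev sg = rcons (belast s (rev sg)) (last s (rev sg)).
  by rewrite lastI.
have cE' : true :: true :: nseq k.+1 false = rcons (true :: true :: nseq k false) false.
  by rewrite /= nseq_rcons.
rewrite sgE cE' in f'E.
have [//|//|] := no_coboundary_last_false _ _ f'E erefl full rig.
- by rewrite size_belast size_rev.
- by rewrite /= size_nseq mE.
- by rewrite c0T.
Qed.

Lemma dual_induction m : [/\ locally_full m, transitive_on m & no_coboundary m].
Proof.
elim: m => [|m [full trans rig]].
  split; [exact: locally_full0| |exact: no_coboundary0].
  move=> w w' sL sR /size0nil-> _ _; case: w' => // _.
  by exists 1, 1; apply: moves_refl.
split; [exact: locally_full_step|exact: transitive_step|exact: no_coboundary_step].
Qed.

(** Otherwise the parity vanishes on all words with the signs of w, that is, it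
    is the coboundary of f = 0. *)
Lemma odd_word_in_orbit w : reduced w -> w != [::] ->
  exists w' al be, moves false false w w' al be /\ parity w'.
Proof.
move=> rw wn; apply: contrapT => none.
have [_ trans rig] := dual_induction (size w).
have [||//|_] := rig (map snd w) (nseq (size w) true) false (fun=> false).
- by rewrite size_map.
- by rewrite size_nseq.
- move=> x u ru su; rewrite mask_true; last by rewrite -(size_map snd u) su size_map.
  have [al [be h]] := trans w u false false erefl rw ru su.
  by apply/esym/negbTE/negP => pu; apply: none; exists u, al, be.
by case: (w) wn.
Qed.

End Dual.

(** * Group words and freeness *)

Section GroupWords.
Variables (G : groupType) (I : eqType) (s : I -> G).
Implicit Types (l k : I * bool) (w u v : seq (I * bool)).

Definition letter_value l : G := if l.2 then (s l.1)^-1 else s l.1.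

Definition flip l := (l.1, ~~ l.2).

Lemma word_value_cons l w :
  word_value s (l :: w) = letter_value l * word_value s w.
Proof. by rewrite /word_value big_cons. Qed.

Lemma word_value_cat w u :
  word_value s (w ++ u) = word_value s w * word_value s u.
Proof. by rewrite /word_value big_cat. Qed.

Lemma word_value_nil : word_value s [::] = 1.
Proof. by rewrite /word_value big_nil. Qed.

Lemma letter_value_flip l : letter_value (flip l) = (letter_value l)^-1.
Proof. by case: l => i [] /=; rewrite /letter_value /= ?invgK. Qed.

Lemma word_value_inv w :
  word_value s (rev (map flip w)) = (word_value s w)^-1.
Proof.
elim: w => [|l w IH]; first by rewrite word_value_nil invg1.
rewrite /= rev_cons -cats1 word_value_cat IH !word_value_cons word_value_nil.
by rewrite mulg1 invgM letter_value_flip.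
Qed.

Definition may_precede l w := if w is k :: _ then k != flip l else true.

Lemma reduced_cons_flip l w : reduced (l :: w) = may_precede l w && reduced w.
Proof.
case: w => [|k w] //=; rewrite /reduced /=; congr (~~ _ && _).
by rewrite eq_sym [k]surjective_pairing xpair_eqE /=; case: (l.2) (k.2) => [] [].
Qed.

Lemma reduced_flip w : reduced (map flip w) = reduced w.
Proof.
elim: w => //= l w IH; rewrite !reduced_cons_flip IH; congr andb.
case: w {IH} => //= k w; congr negb.
by rewrite !xpair_eqE /= (inj_eq negb_inj).
Qed.

(** The words u and v are joined at their heads, which makes the induction on u
    immediate. *)
Lemma reduced_revcat u v : reduced u -> reduced v ->
  (if u is l :: _ then may_precede l v else true) -> reduced (rev u ++ v).
Proof.
elim: u v => //= l u IH v; rewrite reduced_cons_flip => /andP[lu ru] rv lv.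
rewrite rev_cons cat_rcons; apply: IH => //; first by rewrite reduced_cons_flip lv.
case: u lu {ru} => //= k u; apply: contraNneq => ->.
by case: k => i c; rewrite /flip /= negbK.
Qed.

Lemma word_reduction w :
  exists2 u, reduced u & word_value s u = word_value s w.
Proof.
elim: w => [|l w [u ru uw]]; first by exists [::].
have [lu|] := boolP (may_precede l u).
  by exists (l :: u); rewrite ?reduced_cons_flip ?lu // !word_value_cons uw.
case: u ru uw => //= k u; rewrite reduced_cons_flip => /andP[_ ru] uw.
rewrite negbK => /eqP kl; exists u => //.
by rewrite word_value_cons -uw word_value_cons kl letter_value_flip mulKVg.
Qed.

(** Equal first letters cancel; otherwise the inverse of w followed by u is a
    reduced word of value 1. *)
Lemma word_value_inj :
    (forall w, reduced w -> word_value s w = 1 -> w = [::]) ->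
  forall w u, reduced w -> reduced u -> word_value s w = word_value s u -> w = u.
Proof.
move=> free; elim=> [|l w IH] u rw ru wu.
  by apply/esym/free => //; rewrite -wu word_value_nil.
have [lu|] := boolP (may_precede (flip l) u).
  have /(congr1 size) : rev (map flip (l :: w)) ++ u = [::].
    apply: free; last by rewrite word_value_cat word_value_inv wu mulVg.
    by apply: reduced_revcat; rewrite ?reduced_flip.
  by rewrite size_cat size_rev.
case: u ru wu => //= k u ru wu; rewrite negbK => /eqP kl.
have kl' : k = l by rewrite kl; case: (l) => i c; rewrite /flip /= negbK.
move: rw ru wu; rewrite kl' !reduced_cons_flip !word_value_cons.
by move=> /andP[_ rw] /andP[_ ru] /mulgI wu; rewrite (IH u).
Qed.

Lemma generated_subgroupP (S : set G) : is_subgroup (generated_subgroup S).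
Proof.
split=> [H [[]] //|x y Hx Hy H HS].
by have [[_ HB] _] := HS; apply: HB; [apply: Hx|apply: Hy].
Qed.

Lemma freely_generated_range :
    (forall w, reduced w -> word_value s w = 1 -> w = [::]) ->
  freely_generated_by (generated_subgroup (range s)) s.
Proof.
move=> free; split; first exact: generated_subgroupP.
  by move=> i H [_]; apply; exists i.
move=> x Hx; have [w [rw wx]] : exists w, reduced w /\ word_value s w = x.
  apply: (Hx [set y | exists w, reduced w /\ word_value s w = y]%classic).
  split=> [|y [i _ <-]].
    split=> [|y z [w [_ <-]] [u [_ <-]]].
      by exists [::]; rewrite word_value_nil.
    have [v rv vE] := word_reduction (w ++ rev (map flip u)).
    by exists v; rewrite vE word_value_cat word_value_inv.
  by exists [:: (i, false)]; rewrite word_value_cons word_value_nil mulg1.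
exists w; split=> // u [ru ux].
by apply: word_value_inj; rewrite // wx ux.
Qed.

End GroupWords.

Lemma freely_generated_bij (G : groupType) (H : set G) (I J : eqType)
    (s : I -> G) (f : J -> I) :
  bijective f -> freely_generated_by H s -> freely_generated_by H (s \o f).
Proof.
move=> [g fK gK] [subH sH free]; split=> // [j|x Hx]; first exact: sH.
pose F (l : J * bool) := (f l.1, l.2); pose F' (l : I * bool) := (g l.1, l.2).
have FK : cancel F F' by case=> j c; rewrite /F /F' /= fK.
have FK' : cancel F' F by case=> i c; rewrite /F /F' /= gK.
have vF w : word_value (s \o f) w = word_value s (map F w).
  by rewrite /word_value big_map.
have rF w : reduced (map F w) = reduced w.
  rewrite /reduced sorted_map; apply: eq_sorted => l k /=.
  by rewrite (can_eq fK).
have [w [[rw wx] uniq]] := free x Hx.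
exists (map F' w); split=> [|u [ru ux]].
  by rewrite vF -rF -map_comp (eq_map FK') map_id.
have -> : w = map F u by apply: uniq; rewrite rF -vF.
by rewrite -map_comp (eq_map FK) map_id.
Qed.

Section Realize.
Variables (Q : finType) (a b : Q) (pi : {perm Q}) (chi : Q -> bool).
Hypotheses (chi_a : chi a) (chi_b : chi b).
Hypotheses (ab : a != b) (pi_b : pi b = b).
Hypothesis pi_trans : forall q, q != b -> exists k, q = (pi ^+ k) a.
Hypotheses (Q_gt3 : 3 < #|Q|) (Q_even : ~~ odd #|Q|).
Hypothesis chi_odd : \big[addb/false]_q chi q = true.
Variables (A : mealy Q bool) (invA : invertible A).
Hypothesis outA : forall q x, out A q x = x (+) chi q.
Hypothesis nextA : forall q x, Defs.next A q x = turn a b pi x q.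

Let T := transformation invA.
Let dual := dual a b pi chi.
Let parity := parity chi.

(** An inverse letter reads the bit that its state produced, which differs from
    the bit read by the state exactly when the state flips bits; turn_chi
    absorbs the difference. *)
Lemma letter_actionE l x v : letter_value T l (x :: v) =
  x (+) chi l.1 :: letter_value T (turn a b pi (x (+) l.2) l.1, l.2) v.
Proof.
case: l => q [] /=; rewrite /letter_value /=; last first.
  by rewrite outA nextA addbF.
set y := invF _ x; have yx : out A q y = x by apply: f_invF.
have -> : y = x (+) chi q by rewrite -yx outA -addbA addbb addbF.
by rewrite nextA addbC (turn_chi pi chi_a chi_b) addbT.
Qed.

(** A product applies its last factor first, hence the reversal. *)
Lemma word_actionE w x v : word_value T (rev w) (x :: v) =
  x (+) parity w :: word_value T (rev (dual x w)) v.
Proof.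
elim: w x v => [|l w IH] x v.
  by rewrite /rev /= word_value_nil addbF.
rewrite /= !rev_cons -!cats1 !word_value_cat !word_value_cons !word_value_nil.
rewrite !mulg1.
have -> : (word_value T (rev w) * letter_value T l) (x :: v) =
  word_value T (rev w) (letter_value T l (x :: v)) by [].
by rewrite letter_actionE IH addbA.
Qed.

Definition trivial w := word_value T (rev w) = 1.

Lemma trivial_dual x w : trivial w -> ~~ parity w /\ trivial (dual x w).
Proof.
move=> tw; have e v : x (+) parity w = x /\ word_value T (rev (dual x w)) v = v.
  by have := word_actionE w x v; rewrite tw => -[<- <-].
split; first by have [+ _] := e [::]; case: x {e} (parity w) => [] [].
by apply: symP => v; have [_ ->] := e v.
Qed.

(** [dual x] is injective on the finitely many words of a given length. So the
    set of trivial words, closed under [dual x], is closed under its inverse. *)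
Lemma dual_periodic x w : exists k, iter k.+1 (dual x) w = w.
Proof.
pose m := size w.
have sz (t : m.-tuple (Q * bool)) : size (dual x t) == m.
  by rewrite dual_size size_tuple.
pose f t := Tuple (sz t).
have f_inj : injective f.
  by move=> t t' /(congr1 val) /= /dual_inj; apply: val_inj.
have fE k t : val (iter k f t) = iter k (dual x) (val t) by elim: k => //= k ->.
have := iter_order f_inj (in_tuple w) => /(congr1 val).
rewrite fE -[fingraph.order f _]prednK ?order_gt0 // => e.
by exists (fingraph.order f (in_tuple w)).-1.
Qed.

Lemma trivial_dualE x w : trivial (dual x w) <-> trivial w.
Proof.
split=> [tw|]; last by case/(trivial_dual x).
have [k <-] := dual_periodic x w; rewrite iterSr.
by elim: k => //= k /(trivial_dual x)[].
Qed.

Lemma trivial_moves w w' al be :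
  moves a b pi chi false false w w' al be -> trivial w' <-> trivial w.
Proof.
elim=> // {w w' al be} [x w|w w' al be _ IH|w1 w2 w3 al be al' be' _ IH1 _ IH2].
- exact: trivial_dualE.
- by symmetry.
- by rewrite IH2.
Qed.

Lemma trivial_reduced w : reduced w -> trivial w -> w = [::].
Proof.
move=> rw tw; apply/eqP; apply: contraT => wn.
have [w' [al [be [/trivial_moves ww' pw']]]] := odd_word_in_orbit chi_a chi_b ab
  pi_b pi_trans Q_gt3 Q_even chi_odd rw wn.
have /(trivial_dual false)[] : trivial w' by apply/ww'.
by rewrite /parity pw'.
Qed.

Lemma states_free :
  freely_generated_by (automaton_group invA) (transformation invA).
Proof.
apply: freely_generated_range => w rw w1.
by rewrite -[w]revK (@trivial_reduced (rev w)) ?reduced_rev // /trivial revK.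
Qed.

End Realize.

(** * The family of automata *)

Lemma permb_addb (s : {perm bool}) x : s x = x (+) s false.
Proof.
case: x => //=; have : s true != s false by rewrite (inj_eq perm_inj).
by case: (s true) (s false) => [] [].
Qed.

Lemma permb_false (s : {perm bool}) : s false = (s != 1).
Proof.
apply/idP/idP => [sf|]; first by apply: contraTneq sf => ->; rewrite perm1.
apply: contraR => sf; apply/eqP/permP=> x.
by rewrite permb_addb (negPf sf) addbF perm1.
Qed.

Lemma surjective_inj (T : finType) (f : T -> T) :
  (forall y, exists x, f x == y) -> injective f.
Proof.
move=> f_surj; pose g y := xchoose (f_surj y).
have gK : cancel g f by move=> y; apply/eqP/(xchooseP (f_surj y)).
exact: can_inj (canF_sym gK).
Qed.

Lemma odd_card_addb (T : finType) (P : pred T) :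
  odd #|P| = \big[addb/false]_i P i.
Proof.
rewrite -sum1_card (big_morph odd oddD (erefl : odd 0 = false)) big_mkcond /=.
by apply: eq_bigr => i _; rewrite -topredE /=; case: (P i).
Qed.

Lemma card_fstate n : #|{: fstate n}| = n.+3.
Proof.
have <- : #|{: 'I_3 + 'I_n}| = n.+3 by rewrite card_sum !card_ord.
apply: (bij_eq_card (f := @fstate_code n)).
exists (@fstate_decode n); first exact: fstate_codeK.
case=> [[[|[|[|//]]] i]|i] //=; congr inl; apply: val_inj; rewrite /= inordK //.
Qed.

Lemma big_fstate n (F : fstate n -> bool) : \big[addb/false]_q F q =
  F Sa (+) F Sb (+) F Sc (+) \big[addb/false]_(i < n) F (Sd i).
Proof.
rewrite (reindex (@fstate_decode n)) /=; last first.
  exists (@fstate_code n) => x _; last exact: fstate_codeK.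
  case: x => [[[|[|[|//]]] i]|i] //=; congr inl; apply: val_inj; rewrite /= inordK //.
rewrite big_sumType !big_ord_recl big_ord0 /=.
by rewrite addbF !addbA.
Qed.

Section Family.
Variables (n : nat) (A : mealy (fstate n) bool).
Hypothesis famA : in_family A.

Definition next0 (q : fstate n) := Defs.next A q false.
Definition family_chi q := out A q false.

Let n_odd : odd n. Proof. by case: famA. Qed.

Lemma family_out q x : out A q x = x (+) family_chi q.
Proof.
case: famA => _ [sg [_ [[oa _ _] [ob _ _] wc wd wl]]].
have key (s : {perm bool}) : out A q =1 s -> out A q x = x (+) family_chi q.
  by move=> e; rewrite /family_chi !e permb_addb.
case: q key => [|||i] key; [exact: key oa|exact: key ob| |].
  have n_gt0 : 0 < n by case: (n) n_odd.
  by have [e _ _] := wc (Ordinal n_gt0) erefl; apply: key e.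
have := ltn_ord i; rewrite leq_eqVlt => /orP[/eqP iE|lt].
  by have [e _ _] := wl i iE; apply: key e.
by have [e _ _] := wd i (Ordinal lt) erefl; apply: key e.
Qed.

Lemma family_invertible : invertible A.
Proof.
move=> q; exists (fun x => x (+) family_chi q) => x;
by rewrite !family_out -addbA addbb addbF.
Qed.

Lemma family_chi_ab : family_chi Sa /\ family_chi Sb.
Proof.
case: famA => _ [sg [_ [[oa _ _] [ob _ _] _ _ _]]].
by rewrite /family_chi oa ob tpermL.
Qed.

(** The contributions of a and b cancel; the other states correspond to the
    permutations sigma_0, ..., sigma_n. *)
Lemma family_chi_odd : \big[addb/false]_q family_chi q = true.
Proof.
have [chi_a chi_b] := family_chi_ab.
rewrite big_fstate chi_a chi_b /=.
case: famA => _ [sg [sg_odd [_ _ wc wd wl]]].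
rewrite -[RHS]sg_odd odd_card_addb big_ord_recl.
have n_gt0 : 0 < n by case: (n) n_odd.
have [e _ _] := wc (Ordinal n_gt0) erefl.
rewrite {1}/family_chi e permb_false; congr addb; apply: eq_bigr => i _.
have := ltn_ord i; rewrite leq_eqVlt => /orP[/eqP iE|lt].
  by have [f _ _] := wl i iE; rewrite /family_chi f permb_false.
by have [f _ _] := wd i (Ordinal lt) erefl; rewrite /family_chi f permb_false.
Qed.

Lemma family_next0 : [/\ next0 Sa = Sc, next0 Sb = Sb,
    forall i : 'I_n, i = 0 :> nat -> next0 Sc = Sd i,
    forall i j : 'I_n, j = i.+1 :> nat -> next0 (Sd i) = Sd j
  & forall i : 'I_n, i.+1 = n -> next0 (Sd i) = Sa].
Proof.
case: famA => _ [sg [_ [[_ ea _] [_ eb _] wc wd wl]]]; split=> //.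
- by move=> i /wc[].
- by move=> i j /wd[].
- by move=> i /wl[].
Qed.

Lemma iter_next0 (i : 'I_n) : iter i.+2 next0 Sa = Sd i.
Proof.
have [pa pb pc pd pl] := family_next0.
case: i => i; elim: i => [|i IH] lt /=; first by rewrite pa (pc (Ordinal lt)).
have := IH (ltnW lt) => /= ->; exact: pd.
Qed.

Lemma next0_inj : injective next0.
Proof.
have [pa pb pc pd pl] := family_next0.
apply: surjective_inj => q; case: q => [|||i].
- have lt : n.-1 < n by case: (n) n_odd.
  by exists (Sd (Ordinal lt)); rewrite pl //= prednK // (leq_ltn_trans _ lt).
- by exists Sb; rewrite pb.
- by exists Sa; rewrite pa.
- by exists (iter i.+1 next0 Sa); rewrite -iterS iter_next0.
Qed.

Definition family_perm : {perm fstate n} := perm next0_inj.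

Lemma family_perm_trans q : q != Sb -> exists k, q = (family_perm ^+ k) Sa.
Proof.
have [pa pb pc pd pl] := family_next0.
have iterE k : (family_perm ^+ k) Sa = iter k next0 Sa.
  by rewrite permX; apply: eq_iter => x; rewrite permE.
case: q => [|||i] qb.
- by exists 0; rewrite iterE.
- by rewrite eqxx in qb.
- by exists 1%N; rewrite iterE /= pa.
- by exists i.+2; rewrite iterE iter_next0.
Qed.

Lemma family_next q x : Defs.next A q x = turn Sa Sb family_perm x q.
Proof.
have [pa pb pc pd pl] := family_next0.
case: famA => _ [sg [_ [[_ _ ea] [_ _ eb] wc wd wl]]].
have piE r : family_perm r = next0 r by rewrite permE.
case: x => /=; last by rewrite piE.
rewrite permM piE; case: q => [|||i].
- by rewrite tpermL pb.
- by rewrite tpermR pa.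
- rewrite tpermD; [|by apply/eqP|by apply/eqP]; have n_gt0 : 0 < n by case: (n) n_odd.
  by have [_ e e'] := wc (Ordinal n_gt0) erefl; rewrite e' -e.
rewrite tpermD; [|by apply/eqP|by apply/eqP].
have := ltn_ord i; rewrite leq_eqVlt => /orP[/eqP iE|lt].
  by have [_ e e'] := wl i iE; rewrite e' -e.
by have [_ e e'] := wd i (Ordinal lt) erefl; rewrite e' -e.
Qed.

Lemma family_connected : connected A.
Proof.
have [pa pb pc pd pl] := family_next0.
move=> q r; set e := (fun u v => _).
have e_sym : connect_sym e.
  by apply: sym_connect_sym => u v; rewrite /e orbC.
have next_e u x : connect e u (Defs.next A u x).
  by apply/connect1; rewrite /e /edge /=; apply/orP; left; apply/existsP; exists x.
have to_a u : connect e Sa u.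
  have [->|/family_perm_trans[k ->]] := eqVneq u Sb.
    have := next_e Sa true; rewrite family_next /= permM tpermL permE.
    by rewrite pb.
  elim: k => [|k IH]; first by rewrite expg0 perm1 connect0.
  apply: connect_trans IH _; rewrite expgSr permM.
  by have := next_e ((family_perm ^+ k) Sa) false; rewrite family_next.
by apply: connect_trans (to_a r); rewrite e_sym.
Qed.

Lemma family_free (invA : invertible A) :
  freely_generated_by (automaton_group invA) (transformation invA).
Proof.
have [chi_a chi_b] := family_chi_ab.
have [_ pb _ _ _] := family_next0.
apply: (@states_free _ Sa Sb family_perm family_chi) => //.
- exact/eqP.
- by rewrite permE.
- exact: family_perm_trans.
- by rewrite card_fstate; case: (n) n_odd.
- by rewrite card_fstate /= n_odd.
- exact: family_chi_odd.
- exact: family_out.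
- exact: family_next.
Qed.

End Family.

(** The member of the family in which sigma_0 is the transposition and all other
    sigma_k are trivial; [insub] detects the last of the states d_i. *)
Definition sample_next n (q : fstate n) (x : bool) : fstate n :=
  match q with
  | Sa => if x then Sb else Sc
  | Sb => if x then Sc else Sb
  | Sc => if insub 0 is Some i then Sd i else Sa
  | Sd i => if insub i.+1 is Some j then Sd j else Sa
  end.

Definition sample_out n (q : fstate n) (x : bool) : bool :=
  if q is Sd _ then x else ~~ x.

Definition sample n : mealy (fstate n) bool :=
  Mealy (@sample_next n) (@sample_out n).

Lemma sample_in_family n : odd n -> in_family (sample n).
Proof.
move=> n_odd; split=> //.
have flip : (fun x => ~~ x) =1 tperm false true.
  by case; rewrite ?tpermL ?tpermR.
exists (fun k => if k == ord0 then tperm false true else 1); split.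
  rewrite (_ : #|_| = 1%N) // -(card1 (@ord0 n)); apply: eq_card => k.
  rewrite !inE; have [_|_] := eqVneq k ord0; last by rewrite eqxx.
  by apply/eqP => /permP/(_ false); rewrite tpermL perm1.
split.
- by split.
- by split.
- move=> i i0; split=> //=; first by rewrite -i0 valK.
  by rewrite -i0 valK.
- move=> i j ij; split=> [x||] /=; first by rewrite perm1.
    by rewrite -ij valK.
  by rewrite -ij valK.
- move=> i iE; split=> [x||] /=; first by rewrite perm1.
    by rewrite insubF // iE ltnn.
  by rewrite insubF // iE ltnn.
Qed.

Theorem theorem4p9 :
  (forall (n : nat) (M : mealy (fstate n) bool), in_family M ->
     exists invM : invertible M,
       freely_generated_by (automaton_group invM) (transformation invM)) /\
  (forall n : nat, ~~ odd n -> 4 <= n ->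
     exists (Q : finType) (M : mealy Q bool) (invM : invertible M),
       [/\ #|Q| = n,
           connected M,
           freely_generated_by (automaton_group invM) (transformation invM)
         & free_of_rank (automaton_group invM) n]).
Proof.
split=> [n M famM|n n_even n_ge4].
  by exists (family_invertible famM); apply: family_free.
have n3 : n = (n - 3).+3 by rewrite -addn3 subnK // ltnW.
have fam : in_family (sample (n - 3)).
  by apply: sample_in_family; move: n_even; rewrite {1}n3 /= !negbK.
have card_n : #|{: fstate (n - 3)}| = n by rewrite card_fstate -n3.
exists (fstate (n - 3)), (sample (n - 3)), (family_invertible fam).
have free := family_free fam (family_invertible fam).
split=> //; first exact: family_connected.
pose f (i : 'I_n) : fstate (n - 3) := enum_val (cast_ord (esym card_n) i).
exists (transformation (family_invertible fam) \o f).
apply: freely_generated_bij free; apply: bij_comp.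
  by apply: enum_val_bij.
by exists (cast_ord card_n); [apply: cast_ordKV|apply: cast_ordK].
Qed.
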